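(* Let $A\in\mathbb{R}^{n\times n}$ be symmetric with spectrum $\sigma(A)\subset[a,b]$, where $0\leq a<b$, and put $\gamma=a/b$. For every integer $d\geq 2$ let $\mathcal{T}_d(-A\log(A))$ be the probing approximation induced by a distance-$d$ coloring of the graph $\mathcal{G}(A)$. Then for all $d\ge 2$ $$\left|S(A)-\mathcal{T}_d(-A\log(A))\right|\leq n\,b\,(1-\sqrt{\gamma})\,\frac{1+\gamma+2d\sqrt{\gamma}}{2(d^2-1)}\left(\frac{1-\sqrt{\gamma}}{1+\sqrt{\gamma}}\right)^{d}.$$ In particular, if $a=0$, then for all $d\geq 2$ $$\left|S(A)-\mathcal{T}_d(-A\log(A))\right|\leq\frac{nb}{2(d^2-1)}.$$
   Context: For a symmetric matrix $A=U\Lambda U^T$ ($U$ orthogonal, $\Lambda=\mathrm{diag}(\lambda_1,\dots,\lambda_n)$) and a function $f$ defined on the eigenvalues, $f(A)=U\,\mathrm{diag}(f(\lambda_1),\dots,f(\lambda_n))\,U^T$. Here $-A\log(A)$ means $f(A)$ with $f(x)=-x\log x$ (natural logarithm, $0\cdot\log 0=0$), and $S(A)=\mathrm{tr}(-A\log A)=-\sum_{i=1}^n\lambda_i\log\lambda_i$ is the von Neumann entropy (no unit-trace assumption is needed). The graph $\mathcal{G}(A)$ has nodes $\{1,\dots,n\}$ and edges $\{(i,j): [A]_{ij}\neq 0,\ i\neq j\}$. The geodesic distance $\mathrm{d}(i,j)$ is the shortest length (number of edges) of a walk in $\mathcal{G}(A)$ from $i$ to $j$; it is $\infty$ if no such walk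 exists and $0$ if $i=j$. A coloring is a partition $V_1,\dots,V_s$ of $\{1,\dots,n\}$; it is a distance-$d$ coloring if any two distinct nodes $i\ne j$ with $\mathrm{d}(i,j)\leq d$ belong to different sets of the partition. Its probing vectors are $\boldsymbol{v}_\ell=\sum_{i\in V_\ell}\boldsymbol{e}_i\in\mathbb{R}^n$, $\ell=1,\dots,s$, with $\boldsymbol{e}_i$ the canonical basis vectors, and the induced probing approximation of $\mathrm{tr}(f(A))$ is $$\mathcal{T}_d(f(A))=\sum_{\ell=1}^s\boldsymbol{v}_\ell^Tf(A)\boldsymbol{v}_\ell.$$ *)

(* Defs.v *)
From HB Require Import structures.
From mathcomp Require Import all_boot all_order all_algebra.
From mathcomp Require Import all_classical all_reals all_analysis.

Set Implicit Arguments.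
Unset Strict Implicit.
Unset Printing Implicit Defensive.
Import Order.TTheory GRing.Theory Num.Theory.
Local Open Scope classical_set_scope.
Local Open Scope ring_scope.

Definition spectral_decomp (R : realType) (n : nat) (A : 'M[R]_n) :
    set ('M[R]_n * 'rV[R]_n) :=
  [set UL | UL.1^T *m UL.1 = 1%:M /\ A = UL.1 *m diag_mx UL.2 *m UL.1^T].

(* f(A) is computed from an arbitrarily chosen decomposition, which exists when
   A is symmetric; by matfunE the result does not depend on the choice.  If A is
   not symmetric there is no decomposition and the value is meaningless. *)
Definition matfun (R : realType) (n : nat) (f : R -> R) (A : 'M[R]_n) :
    'M[R]_n :=
  let UL := xget (1%:M, 0) (spectral_decomp A) in
  UL.1 *m diag_mx (map_mx f UL.2) *m UL.1^T.

Lemma matfunE (R : realType) (n : nat) (f : R -> R) (A U : 'M[R]_n)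
    (lam : 'rV[R]_n) :
  U^T *m U = 1%:M -> A = U *m diag_mx lam *m U^T ->
  matfun f A = U *m diag_mx (map_mx f lam) *m U^T.
Proof.
move=> UU AE; rewrite /matfun.
have : spectral_decomp A (xget (1%:M, 0) (spectral_decomp A)).
  by apply: (@xgetPex _ (1%:M, 0)); exists (U, lam).
case: (xget _ _) => V mu [/= VV AE'].
have UU' : U *m U^T = 1%:M by apply: mulmx1C.
have VV' : V *m V^T = 1%:M by apply: mulmx1C.
pose W := V^T *m U.
have DW : diag_mx mu *m W = W *m diag_mx lam.
  have -> : diag_mx mu *m W = V^T *m A *m U.
    by rewrite AE' /W !mulmxA VV mul1mx.
  by rewrite AE /W !mulmxA -(mulmxA _ U^T U) UU mulmx1.
have fW : diag_mx (map_mx f mu) *m W = W *m diag_mx (map_mx f lam).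
  apply/matrixP => i j; move/matrixP/(_ i j): DW.
  rewrite !mul_diag_mx !mul_mx_diag !mxE => /eqP.
  rewrite mulrC -subr_eq0 -mulrBr mulf_eq0 => /orP[/eqP-> |].
    by rewrite mulr0 mul0r.
  by rewrite subr_eq0 => /eqP->; rewrite mulrC.
have -> : V *m diag_mx (map_mx f mu) *m V^T
        = V *m (diag_mx (map_mx f mu) *m W) *m U^T.
  by rewrite /W !mulmxA -(mulmxA _ U U^T) UU' mulmx1.
by rewrite fW /W !mulmxA VV' mul1mx.
Qed.

(* MathComp-Analysis sets ln x = 0 for x <= 0, and 0 * ln 0 = 0 in any case. *)
Definition negxlnx (R : realType) (x : R) : R := - (x * ln x).

Definition vn_entropy (R : realType) (n : nat) (A : 'M[R]_n) : R :=
  \tr (matfun (@negxlnx R) A).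

Definition edge (R : realType) (n : nat) (A : 'M[R]_n) : rel 'I_n :=
  fun i j => (A i j != 0) && (i != j).

(* A walk i = x_0, x_1, ..., x_k = j is encoded by p = [:: x_1; ...; x_k], so
   its length is size p.  The infimum over the empty set is +oo. *)
Definition geodesic (R : realType) (n : nat) (A : 'M[R]_n) (i j : 'I_n) :
    \bar R :=
  ereal_inf [set ((size p)%:R%:E : \bar R) |
             p in [set p : seq 'I_n | path (edge A) i p /\ last i p = j]].

Definition distance_coloring (R : realType) (n : nat) (A : 'M[R]_n) (d : nat)
    (P : {set {set 'I_n}}) : Prop :=
  finset.partition P [set: 'I_n]%SET /\
  (forall i j : 'I_n, i != j -> (geodesic A i j <= d%:R%:E)%E ->
     finset.pblock P i != finset.pblock P j).

Definition probing_vector (R : realType) (n : nat) (V : {set 'I_n}) :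
    'cV[R]_n :=
  \sum_(i in V) delta_mx i 0.

(* The summand is a 1 x 1 matrix; "0 0" extracts its entry. *)
Definition probing_trace (R : realType) (n : nat) (P : {set {set 'I_n}})
    (F : 'M[R]_n) : R :=
  \sum_(V in P)
    ((probing_vector R V)^T *m F *m probing_vector R V) 0 0.

(* Main.v *)
Require Import Defs.
From HB Require Import structures.
From mathcomp Require Import all_boot all_order all_algebra.
From mathcomp Require Import all_classical all_reals all_analysis.
From mathcomp Require Import ring lra.
From mathcomp Require Import complex.
Import Order.TTheory GRing.Theory Num.Theory.
Local Open Scope ring_scope.

Set Implicit Arguments.
Unset Strict Implicit.
Unset Printing Implicit Defensive.

(** Write A = U diag(lam) U^T.  For every f the probing error
    tr f(A) - T_d(f(A)) equals L(f) = sum_k w_k f(lam_k), where w_k is 1 minus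
    the sum of the squares of the k-th spectral coordinates of the probing
    vectors.  The functional L has two properties, and only these are used
    ([probing_error_functional]).  It vanishes on polynomials of degree at most
    d, because (A^k)_ij <> 0 forces a walk of length at most k from i to j, so
    that for k <= d two distinct nodes of one colour contribute nothing to the
    probing of A^k.  And sum_k |w_k| <= 2n: every 1 - w_k is nonnegative, and
    their sum is n because L(1) = 0.

    It remains to bound L(x ln x) for such a functional.  Affinely, let
    x = h (y + (r0 + 1/r0)/2) with y in [-1, 1]; for g = sqrt(a/b) this is
    achieved by r0 = (1-g)/(1+g) and h = (b-a)/2.  Put
      F(r) = L(x ln N_r),  N_r(y) = 1 + 2 y r + r^2,  0 <= r <= r0.
    Then F(0) = 0.  Since N_r0 is a constant multiple of x, and L(x) = 0, also
    F(r0) = L(x ln x).  So it suffices to bound F'(r) and integrate.  Now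
    F'(r) = L(x (2y + 2r)/N_r), and the division of this rational function of y
    by N_r leaves a linear polynomial plus a constant k(r) over N_r; hence
    F'(r) = k(r) L(1/N_r).  By [kernel_poly_approx] the kernel 1/N_r lies within
    2 r^(d+1) / (1 - r^2)^2 of a polynomial of degree d (a classical best
    approximation of Chebyshev).  An arithmetic-geometric mean inequality turns
    the resulting bound into a multiple of r^(d-2) - r^d, whose primitive at r0
    gives the stated closed form ([entropy_functional_le] and
    [entropy_functional_interval]).

    Working with L instead of with approximants of x ln x means that only one
    real function of one variable is ever differentiated. *)

(** * Chebyshev polynomials *)

(** The pair (T_k(y), U_(k-1)(y)), that is (cos k t, sin k t / sin t) at
    y = cos t: the recursion is the addition formula for the angle t. *)
Fixpoint chebyshev (R : pzRingType) (y : R) (k : nat) : R * R :=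
  if k is k'.+1 then
    let: (t, u) := chebyshev y k' in
    (y * t - (1 - y ^+ 2) * u, t + y * u)
  else (1, 0).

(** cos^2 + sin^2 = 1 for the angle k t. *)
Lemma chebyshev_pell (R : comPzRingType) (y : R) (k : nat) :
  (chebyshev y k).1 ^+ 2 + (1 - y ^+ 2) * (chebyshev y k).2 ^+ 2 = 1.
Proof.
elim: k => [|k IH] /=; first by ring.
by move: IH; case: (chebyshev y k) => t u /= E; rewrite -[RHS]E; ring.
Qed.

Lemma size_chebyshev (R : nzRingType) (k : nat) :
  (size (chebyshev ('X : {poly R}) k).1 <= k.+1)%N
  /\ (size (chebyshev ('X : {poly R}) k).2 <= k)%N.
Proof.
elim: k => [|k IH] /=; first by rewrite size_poly1 size_poly0.
move: IH; case: (chebyshev _ k) => t u /= [st su].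
have sX (p : {poly R}) m : (size p <= m)%N -> (size ('X * p)%R <= m.+1)%N.
  move=> sp; rewrite -commr_polyX (leq_trans (size_polyMleq _ _)) //.
  by rewrite size_polyX addn2.
split.
  rewrite (leq_trans (size_polyD _ _)) // geq_max sX //= size_polyN.
  rewrite mulrBl mul1r (leq_trans (size_polyD _ _)) // geq_max size_polyN.
  by rewrite expr2 -mulrA (leq_trans su) ?sX // -addn2 leq_addr.
by rewrite (leq_trans (size_polyD _ _)) // geq_max st sX.
Qed.

Lemma horner_chebyshev (R : comNzRingType) (y : R) (k : nat) :
  (chebyshev 'X k).1.[y] = (chebyshev y k).1
  /\ (chebyshev 'X k).2.[y] = (chebyshev y k).2.
Proof.
elim: k => [|k] /=; first by rewrite hornerC horner0.
by case: (chebyshev _ k) (chebyshev y k) => t u [t' u'] /= [<- <-]; rewrite !hornerE.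
Qed.

(** At y = - (r + 1/r)/2, the zero of 1 + 2 y r + r^2, the recursion of
    [chebyshev] is diagonalizable with eigenvalues - r and - 1/r; the left-hand
    side is the eigenform for - 1/r. *)
Lemma chebyshev_at_pole (R : fieldType) (r y : R) (k : nat) :
  r != 0 -> 2 * r * y = - (1 + r ^+ 2) ->
  (1 - r ^+ 2) * (chebyshev y k).2 - 2 * r * (chebyshev y k).1
  = - 2 * r * (- r^-1) ^+ k.
Proof.
move=> r0 yE; elim: k => [|k IH] /=; first by ring.
rewrite [_ ^+ k.+1]exprS mulrCA -IH; case: (chebyshev y k) => t u /=.
apply: (mulfI r0).
transitivity (r * (1 - r ^+ 2) * t - r * t * (2 * r * y)
  + (r * (1 - r ^+ 2) * y + 2 * r ^+ 2 - r * y * (2 * r * y)) * u); first by ring.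
rewrite yE; transitivity (2 * r * t + (2 * r * y + 2 * r ^+ 2) * u); first by ring.
by rewrite yE; field.
Qed.

(** * Polynomial approximation of the kernel 1 / (1 + 2 y r + r^2) *)

Lemma kernel_gt0 (R : realDomainType) (r y : R) :
  -1 <= y <= 1 -> 0 <= r < 1 -> 0 < 1 + 2 * y * r + r ^+ 2.
Proof. by move=> /andP[y1 y2] /andP[r0 r1]; nra. Qed.

(** With y = cos t and z = e^(i t), let W(y) be the real part of
    z^d (z + r) (1 + r / z), a polynomial of degree d + 1 in y.  As |z| = 1, this
    gives |W(y)| <= |z + r|^2 = N, where N = 1 + 2 y r + r^2.  The constant C
    makes 1 - C W vanish at the zero of N, so 1 - C W = N q with q of degree d,
    and 1/N - q = C W / N has modulus at most |C|. *)
Lemma kernel_poly_approx (R : realType) (r : R) (d : nat) : 0 < r < 1 ->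
  exists2 q : {poly R}, (size q <= d.+1)%N &
  forall y, -1 <= y <= 1 ->
    `|(1 + 2 * y * r + r ^+ 2)^-1 - q.[y]|
    <= 2 * r ^+ d.+1 / (1 - r ^+ 2) ^+ 2.
Proof.
move=> /andP[r_gt0 r_lt1]; have r_neq0 : r != 0 by rewrite gt_eqF.
have r2 : 1 - r ^+ 2 > 0 by nra.
pose C := 2 * (- r) ^+ d.+1 / (1 - r ^+ 2) ^+ 2.
have C_abs : `|C| = 2 * r ^+ d.+1 / (1 - r ^+ 2) ^+ 2.
  rewrite /C normrM normfV normrM !normrX normrN normr_nat.
  by rewrite (gtr0_norm r_gt0) (gtr0_norm r2).
pose W (y : R) := (chebyshev y d).1 * ((1 + r ^+ 2) * y + 2 * r)
  - (1 - r ^+ 2) * (1 - y ^+ 2) * (chebyshev y d).2.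
pose p : {poly R} := 1 - C%:P *
  ((chebyshev 'X d).1 * ((1 + r ^+ 2)%:P * 'X + (2 * r)%:P)
   - (1 - r ^+ 2)%:P * (1 - 'X ^+ 2) * (chebyshev 'X d).2).
have pE y : p.[y] = 1 - C * W y.
  by have [tE uE] := horner_chebyshev y d; rewrite /p !hornerE tE uE /W.
have size_p : (size p <= d.+2)%N.
  have [sT sU] := size_chebyshev R d.
  have sZ (c : R) (f : {poly R}) : (size (c%:P * f)%R <= size f)%N.
    by rewrite mul_polyC size_scale_leq.
  have sM (f g : {poly R}) (k l : nat) : (size f <= k.+1)%N -> (size g <= l)%N ->
      (size (f * g)%R <= k + l)%N.
    move=> sf sg; rewrite (leq_trans (size_polyMleq _ _)) //.
    by rewrite -subn1 leq_subLR add1n -addSn leq_add.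
  rewrite (leq_trans (size_polyD _ _)) // geq_max size_poly1 /= size_polyN.
  rewrite (leq_trans (sZ _ _)) // (leq_trans (size_polyD _ _)) // geq_max.
  rewrite size_polyN -mulrA; apply/andP; split.
    rewrite mulrC (sM _ _ 1%N d.+1) // size_MXaddC; case: ifP => // _.
    by rewrite ltnS size_polyC_leq1.
  rewrite (leq_trans (sZ _ _)) // (sM _ _ 2%N d) //.
  rewrite (leq_trans (size_polyD _ _)) // geq_max size_polyN size_polyXn.
  by rewrite size_poly1.
pose z := - (1 + r ^+ 2) / (2 * r).
have zE : 2 * r * z = - (1 + r ^+ 2) by rewrite /z; field.
have : root p z.
  rewrite rootE pE subr_eq0 eq_sym; apply/eqP.
  have W_z : W z = (1 - r ^+ 2) ^+ 2 / (4 * r ^+ 2)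
      * ((1 - r ^+ 2) * (chebyshev z d).2 - 2 * r * (chebyshev z d).1).
    by rewrite /W; case: (chebyshev z d) => t u /=; rewrite /z; field.
  have rd : (- r) ^+ d * (- r^-1) ^+ d = 1.
    by rewrite -exprMn mulrNN mulfV // expr1n.
  rewrite W_z (chebyshev_at_pole _ r_neq0 zE) /C exprS -[RHS]rd.
  by field; rewrite r_neq0 gt_eqF.
move=> /factor_theorem[q pq].
exists ((2 * r)^-1 *: q).
  rewrite (leq_trans (size_scale_leq _ _)) //.
  have [->|q0] := eqVneq q 0; first by rewrite size_poly0.
  by move: size_p; rewrite pq size_Mmonic ?monicXsubC // size_XsubC addn2.
move=> y yI.
have N_gt0 : 0 < 1 + 2 * y * r + r ^+ 2.
  by apply: kernel_gt0; rewrite // ltW.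
have -> : (1 + 2 * y * r + r ^+ 2)^-1 - ((2 * r)^-1 *: q).[y]
    = C * W y / (1 + 2 * y * r + r ^+ 2).
  have -> : C * W y = 1 - p.[y] by rewrite pE; ring.
  rewrite pq !hornerE /z; field.
  by rewrite r_neq0 gt_eqF.
rewrite normrM normfV normrM C_abs (gtr0_norm N_gt0) ler_pdivrMr //.
rewrite ler_wpM2l //; first by rewrite -C_abs.
rewrite -(ger0_norm (ltW N_gt0)) -ler_sqr ?nnegrE //.
rewrite !real_normK ?num_real // /W.
have := chebyshev_pell y d.
case: (chebyshev y d) => t u /= tu.
have y2 : 0 <= 1 - y ^+ 2 by move: yI => /andP[? ?]; nra.
(* Cauchy-Schwarz in the weighted form of [chebyshev_pell], with its defect
   made explicit as a square. *)
have -> : (1 + 2 * y * r + r ^+ 2) ^+ 2 =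
  (t * ((1 + r ^+ 2) * y + 2 * r) - (1 - r ^+ 2) * (1 - y ^+ 2) * u) ^+ 2
  + (1 - y ^+ 2) * (((1 + r ^+ 2) * y + 2 * r) * u + (1 - r ^+ 2) * t) ^+ 2.
  transitivity ((t ^+ 2 + (1 - y ^+ 2) * u ^+ 2) * (1 + 2 * y * r + r ^+ 2) ^+ 2).
    by rewrite tu mul1r.
  by ring.
by rewrite lerDl mulr_ge0 ?sqr_ge0.
Qed.

(** * Functionals annihilating polynomials of low degree *)

Lemma is_derive_monomial_gap (R : realType) (c : R) (k : nat) (r : R) :
  is_derive r 1 (fun s : R => c * (s ^+ k.+1 / k.+1%:R - s ^+ k.+3 / k.+3%:R))
    (c * (r ^+ k - r ^+ k.+2)).
Proof.
have -> : (fun s : R => c * (s ^+ k.+1 / k.+1%:R - s ^+ k.+3 / k.+3%:R))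
  = c *: (k.+1%:R^-1 *: (@id R) ^+ k.+1 - k.+3%:R^-1 *: (@id R) ^+ k.+3).
  apply/funext => s; rewrite !fctE /GRing.scale /=.
  by rewrite [X in X - _]mulrC [X in _ - X]mulrC.
apply: is_derive_eq.
by rewrite /GRing.scale /= !mulr1 !mulKf ?pnatr_eq0.
Qed.

Section AnnihilatingFunctional.
Variables (R : realType) (n d : nat) (w : 'I_n -> R) (M : R).
Hypothesis wM : \sum_i `|w i| <= M.

Lemma ler_norm_functional (e : R) (g : 'I_n -> R) :
  (forall i, `|g i| <= e) -> 0 <= e -> `|\sum_i w i * g i| <= M * e.
Proof.
move=> ge e0; rewrite (le_trans (ler_norm_sum _ _ _)) //.
rewrite (@le_trans _ _ (\sum_i `|w i| * e)) //.
  by apply: ler_sum => i _; rewrite normrM ler_wpM2l.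
by rewrite -mulr_suml ler_wpM2r.
Qed.

Variable y : 'I_n -> R.
Hypothesis yI : forall i, -1 <= y i <= 1.
Hypothesis w0 : forall q : {poly R}, (size q <= d.+1)%N ->
  \sum_i w i * q.[y i] = 0.

(** Subtracting an approximating polynomial does not change the functional. *)
Lemma kernel_functional (r : R) : 0 < r < 1 ->
  `|\sum_i w i / (1 + 2 * y i * r + r ^+ 2)|
  <= M * (2 * r ^+ d.+1 / (1 - r ^+ 2) ^+ 2).
Proof.
move=> r01; have [q sq qP] := kernel_poly_approx d r01.
rewrite -[X in `|X|]subr0 -[X in _ - X](w0 sq) -sumrB.
under eq_bigr do rewrite -mulrBr.
apply: ler_norm_functional => [i|]; first exact: qP.
move: r01 => /andP[r0 _]; rewrite mulr_ge0 ?invr_ge0 ?sqr_ge0 //.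
by rewrite mulr_ge0 ?exprn_ge0 ?ltW.
Qed.

Variables (h r0 : R) (x : 'I_n -> R).
Hypothesis h0 : 0 <= h.
Hypothesis r0I : 0 < r0 <= 1.
Hypothesis d2 : (2 <= d)%N.
Hypothesis xE : forall i, x i = h * (y i + (r0 + r0^-1) / 2).

(** The function of y under the sum is k h / N + q, with N = 1 + 2 y r + r^2, a
    linear polynomial q, and k the value of (2 y + 2 r) x / h at the zero of N.
    With u = r0 - r and v = r (1 - r r0) one has u + v = r0 (1 - r^2), and
    [kernel_functional] reduces the bound to 4 u v <= (u + v)^2. *)
Lemma entropy_functional_deriv (r : R) : 0 < r < r0 ->
  `|\sum_i w i * (x i * ((2 * y i + 2 * r) / (1 + 2 * y i * r + r ^+ 2)))|
  <= M * h * r0 / 4 * (r ^+ (d - 2) - r ^+ d).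
Proof.
move=> /andP[r_gt0 r_lt]; have [r0_gt0 r0_le1] := andP r0I.
have r_lt1 : r < 1 by exact: lt_le_trans r_lt _.
have M0 : 0 <= M by apply: le_trans wM; apply: sumr_ge0.
have r2 : 0 < 1 - r ^+ 2 by nra.
pose k := (r^-1 - r) * ((r + r^-1) / 2 - (r0 + r0^-1) / 2).
pose q : {poly R} := (h / r)%:P * 'X
  + (h * ((r0 + r0^-1) / 2 / r - (1 - r ^+ 2) / (2 * r ^+ 2)))%:P.
have sq : (size q <= d.+1)%N.
  rewrite size_MXaddC; case: ifP => // _.
  by rewrite ltnS (leq_trans (size_polyC_leq1 _)) // ltnW.
have -> : \sum_i w i * (x i * ((2 * y i + 2 * r) / (1 + 2 * y i * r + r ^+ 2)))
   = h * k * \sum_i w i / (1 + 2 * y i * r + r ^+ 2).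
  rewrite -[LHS]subr0 -[X in _ - X](w0 sq) -sumrB mulr_sumr; apply: eq_bigr => i _.
  have N0 : 0 < 1 + 2 * y i * r + r ^+ 2 by apply: kernel_gt0; rewrite // ltW.
  rewrite /q xE /k hornerMXaddC hornerC; field.
  by rewrite !gt_eqF.
have kE : k = (1 - r ^+ 2) * ((r0 - r) * (1 - r * r0)) / (2 * r ^+ 2 * r0).
  by rewrite /k; field; rewrite !gt_eqF.
have k_ge0 : 0 <= k.
  have rr0 : 0 <= 1 - r * r0 by nra.
  have r0r : 0 <= r0 - r by lra.
  rewrite kE; apply: divr_ge0; first by rewrite !mulr_ge0 // ltW.
  by rewrite !mulr_ge0 ?sqr_ge0 // ltW.
have kP : k * (2 * r ^+ d.+1 / (1 - r ^+ 2) ^+ 2)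
    <= r0 / 4 * (r ^+ (d - 2) - r ^+ d).
  rewrite -subr_ge0; have dE : d = (d - 2).+2 by rewrite -addn2 subnK.
  have -> : r ^+ d.+1 = r ^+ (d - 2) * r ^+ 3 by rewrite -exprD addn3 {1}dE.
  have -> : r ^+ d = r ^+ (d - 2) * r ^+ 2 by rewrite -exprD subnK.
  have -> : r0 / 4 * (r ^+ (d - 2) - r ^+ (d - 2) * r ^+ 2) -
      k * (2 * (r ^+ (d - 2) * r ^+ 3) / (1 - r ^+ 2) ^+ 2)
      = r ^+ (d - 2) * ((r0 - r) - r * (1 - r * r0)) ^+ 2
        / (4 * r0 * (1 - r ^+ 2)).
    by rewrite kE; field; rewrite !gt_eqF.
  apply: divr_ge0; first by rewrite mulr_ge0 ?sqr_ge0 // exprn_ge0 // ltW.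
  by rewrite !mulr_ge0 // ltW.
have r01 : 0 < r < 1 by rewrite r_gt0.
apply: (@le_trans _ _ (h * k * (M * (2 * r ^+ d.+1 / (1 - r ^+ 2) ^+ 2)))).
  have hk : 0 <= h * k by rewrite mulr_ge0.
  by rewrite normrM (ger0_norm hk); apply: ler_wpM2l => //; exact: kernel_functional.
have -> : h * k * (M * (2 * r ^+ d.+1 / (1 - r ^+ 2) ^+ 2))
  = M * h * (k * (2 * r ^+ d.+1 / (1 - r ^+ 2) ^+ 2)) by ring.
rewrite -[M * h * r0 / 4]mulrA -[M * h * _ * _]mulrA.
by apply: ler_wpM2l => //; rewrite mulr_ge0.
Qed.

(** Let F(r) be the functional of x ln (1 + 2 y r + r^2).  Then F(0) = 0, and
    F(r0) is the functional of x ln x, as 1 + 2 y r0 + r0^2 = (2 r0 / h) x and x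
    is annihilated.  By [entropy_functional_deriv], |F'| is at most the
    derivative of the function G of r0 on the right-hand side, so both G - F
    and G + F are nondecreasing. *)
Lemma entropy_functional_le :
  `|\sum_i w i * (x i * ln (x i))|
  <= M * h * r0 / 4 * (r0 ^+ d.-1 / d.-1%:R - r0 ^+ d.+1 / d.+1%:R).
Proof.
have [r0_gt0 r0_le1] := andP r0I.
pose N i (r : R) := 1 + 2 * y i * r + r ^+ 2.
pose F i (r : R) := w i * (x i * ln (N i r)).
pose F' i (r : R) := w i * (x i * ((2 * y i + 2 * r) / N i r)).
(* At r = r0 = 1 the logarithm is singular only for y = -1, where x = 0. *)
have N_gt0 i (r : R) : x i != 0 -> 0 <= r <= r0 -> 0 < N i r.
  move=> xi /andP[r_ge0 r_le]; have [r_lt1|r_ge1] := ltP r 1.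
    by apply: kernel_gt0 => //; rewrite r_ge0.
  have r1 : r = 1 by lra.
  have r01 : r0 = 1 by lra.
  have /andP[yl _] := yI i.
  have yN : y i != -1.
    by apply: contraNneq xi => yE; rewrite xE yE r01 invr1; apply/eqP; field.
  have : -1 < y i by rewrite lt_neqAle eq_sym yN yl.
  by rewrite /N r1; lra.
have FP i (r : R) : 0 <= r <= r0 -> is_derive r 1 (F i) (F' i r).
  move=> /andP[r_ge0 r_le].
  have [xi0|xi_neq0] := eqVneq (x i) 0.
    have -> : F i = cst 0 by apply/funext => s; rewrite /F xi0 mul0r mulr0.
    by rewrite /F' xi0 mul0r mulr0; exact: is_derive_cst.
  have Nr_gt0 : 0 < N i r by apply: N_gt0; rewrite ?r_ge0.
  have NP : is_derive r 1 (N i) (2 * y i + 2 * r).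
    rewrite /N; apply: is_derive_eq; rewrite /GRing.scale /=; ring.
  have lnP := is_derive1_comp (is_derive1_ln Nr_gt0) NP.
  have -> : F i = (w i * x i) *: (@ln R \o N i).
    by apply/funext => s; rewrite /F /= mulrA.
  apply: is_derive_eq; rewrite /F' /GRing.scale /= -mulrA.
  by rewrite [X in _ * (_ * X)]mulrC.
pose G (r : R) := M * h * r0 / 4 * (r ^+ d.-1 / d.-1%:R - r ^+ d.+1 / d.+1%:R).
pose G' (r : R) := M * h * r0 / 4 * (r ^+ (d - 2) - r ^+ d).
have GP (r : R) : is_derive r 1 G (G' r).
  have [k dE] : exists k, d = k.+2 by exists (d - 2)%N; rewrite -addn2 subnK.
  by rewrite /G /G' dE subn2; exact: is_derive_monomial_gap.
have sumFP (r : R) : 0 <= r <= r0 ->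
    is_derive r 1 (\sum_i F i) (\sum_i F' i r).
  move=> rI; apply: is_derive_sum => i; exact: FP.
have FG (s : bool) (r : R) : 0 <= r <= r0 ->
    is_derive r 1 (G + (-1) ^+ s *: \sum_i F i) (G' r + (-1) ^+ s *: \sum_i F' i r).
  by move=> /sumFP ?; apply: is_deriveD.
have mono (s : bool) : G 0 + (-1) ^+ s * \sum_i F i 0
    <= G r0 + (-1) ^+ s * \sum_i F i r0.
  have FGd (r : R) : 0 <= r <= r0 -> derivable (G + (-1) ^+ s *: \sum_i F i) r 1.
    by move=> rI; case: (FG s _ rI).
  have H0 : {in `[0, r0] &, {homo (G + (-1) ^+ s *: \sum_i F i) : u v / u <= v}}.
    apply: ger0_derive1_le_cc.
    - by move=> r /itvP rI; apply: FGd; rewrite !rI.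
    - move=> r /itvP rI; have rI' : 0 <= r <= r0 by rewrite !rI.
      rewrite derive1E (@derive_val _ _ _ _ _ _ _ (FG s _ rI')).
      have : `|\sum_i F' i r| <= G' r.
        by apply: entropy_functional_deriv => //; rewrite !rI.
      rewrite ler_norml /GRing.scale /= => /andP[? ?].
      by case: s {FGd} => /=; rewrite ?expr0 ?expr1; lra.
    - by apply: derivable_within_continuous => r; rewrite in_itv /= => /FGd.
  have := H0 0 r0; rewrite !in_itv /= !lexx (ltW r0_gt0) => /(_ isT isT isT).
  by rewrite !fctE !fct_sumE.
have F0 : \sum_i F i 0 = 0.
  apply: big1 => i _.
  by rewrite /F /N mulr0 expr0n /= !addr0 ln1 !mulr0.
have Fr0 : \sum_i F i r0 = \sum_i w i * (x i * ln (x i)).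
  pose q : {poly R} := h%:P * 'X + (h * ((r0 + r0^-1) / 2))%:P.
  have sq : (size q <= d.+1)%N.
    rewrite size_MXaddC; case: ifP => // _.
    by rewrite ltnS (leq_trans (size_polyC_leq1 _)) // ltnW.
  have wx : \sum_i w i * x i = 0.
    rewrite -[RHS](w0 sq); apply: eq_bigr => i _.
    by rewrite /q hornerMXaddC hornerC xE mulrDr.
  rewrite -[RHS]subr0 -[X in _ - X](mulr0 (ln (h / (2 * r0)))) -[X in _ * X]wx.
  rewrite mulr_sumr -sumrB; apply: eq_bigr => i _; rewrite /F.
  have [->|xi] := eqVneq (x i) 0; first by rewrite !(mul0r, mulr0) subrr.
  have Ni : 0 < N i r0 by apply: N_gt0; rewrite // lexx ltW.
  have h_gt0 : 0 < h.
    rewrite lt_neqAle h0 andbT eq_sym.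
    by apply: contraNneq xi => hE; rewrite xE hE mul0r.
  have -> : x i = N i r0 * (h / (2 * r0)).
    by rewrite xE /N; field; rewrite gt_eqF.
  rewrite lnM ?posrE ?divr_gt0 ?mulr_gt0 //; ring.
have G0 : G 0 = 0.
  by rewrite /G !expr0n; case: d d2 => [|[|k]] //= _; rewrite !mul0r subr0 mulr0.
rewrite -/(G r0) -Fr0 ler_norml; apply/andP; split.
  by have := mono false; rewrite F0 G0 expr0 mul1r; lra.
by have := mono true; rewrite F0 G0 expr1 mulr0 addr0; lra.
Qed.
End AnnihilatingFunctional.

(** Here g stands for sqrt(a/b), where a = b g^2 is the left end of the
    interval.  The value given by [entropy_functional_le] is exactly
    1/(1+g) times the bound below. *)
Lemma entropy_functional_interval (R : realType) (n d : nat)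
    (w x : 'I_n -> R) (M b g : R) :
  0 < b -> 0 <= g < 1 -> (2 <= d)%N -> (forall i, b * g ^+ 2 <= x i <= b) ->
  \sum_i `|w i| <= M ->
  (forall q : {poly R}, (size q <= d.+1)%N -> \sum_i w i * q.[x i] = 0) ->
  `|\sum_i w i * (x i * ln (x i))|
  <= M * (b * (1 - g) * ((1 + g ^+ 2 + 2 * d%:R * g) / (4 * (d%:R ^+ 2 - 1)))
          * ((1 - g) / (1 + g)) ^+ d).
Proof.
move=> b_gt0 /andP[g_ge0 g_lt1] d2 xI wM w0.
have M_ge0 : 0 <= M by apply: le_trans wM; apply: sumr_ge0.
pose r0 := (1 - g) / (1 + g); pose h := b * (1 - g ^+ 2) / 2.
have r0I : 0 < r0 <= 1.
  by rewrite divr_gt0 ?ler_pdivrMr ?subr_gt0; lra.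
have g2 : 0 < 1 - g ^+ 2 by nra.
have h_gt0 : 0 < h by rewrite divr_gt0 // mulr_gt0.
pose y i := x i / h - (r0 + r0^-1) / 2.
have xE i : x i = h * (y i + (r0 + r0^-1) / 2).
  by rewrite subrK mulrC divfK ?gt_eqF.
have yE i : y i = (2 * x i - b * (1 + g ^+ 2)) / (b * (1 - g ^+ 2)).
  rewrite /y /h /r0; field; rewrite !gt_eqF //; lra.
have yI i : -1 <= y i <= 1.
  have bg : 0 < b * (1 - g ^+ 2) by rewrite mulr_gt0.
  have /andP[xl xu] := xI i.
  by rewrite yE ler_pdivlMr // ler_pdivrMr //; apply/andP; split; lra.
have w0y (q : {poly R}) : (size q <= d.+1)%N -> \sum_i w i * q.[y i] = 0.
  move=> sq; pose l : {poly R} := h^-1%:P * 'X + (- ((r0 + r0^-1) / 2))%:P.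
  have sl : size l = 2%N.
    rewrite /l size_MXaddC size_polyC polyC_eq0 invr_eq0 (gt_eqF h_gt0) /=.
    by [].
  rewrite -[RHS](w0 (q \Po l)) ?size_comp_poly2 //.
  apply: eq_bigr => i _; rewrite horner_comp /l hornerMXaddC hornerC /y.
  by rewrite [h^-1 * _]mulrC.
apply: le_trans (entropy_functional_le wM yI w0y (ltW h_gt0) r0I d2 xE) _.
have [k dE] : exists k, d = k.+2 by exists (d - 2)%N; rewrite -addn2 subnK.
pose E := M * b * ((1 + g ^+ 2 + 2 * d%:R * g) / (4 * (d%:R ^+ 2 - 1))) * r0 ^+ d.
have r0_gt0 : 0 < r0 by have /andP[] := r0I.
have dR : d%:R = k%:R + 2 :> R by rewrite dE -addn2 natrD.
have k_ge0 : 0 <= k%:R :> R by [].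
have E_ge0 : 0 <= E.
  apply: mulr_ge0; last by rewrite exprn_ge0 // ltW.
  apply: mulr_ge0; first by rewrite mulr_ge0 // ltW.
  by rewrite dR; apply: divr_ge0; nra.
have -> : M * h * r0 / 4 * (r0 ^+ d.-1 / d.-1%:R - r0 ^+ d.+1 / d.+1%:R) = r0 * E.
  have k3 : k.+3%:R = k%:R + 3 :> R by rewrite -natrD addn3.
  rewrite /E dR dE /= -[k.+1%:R]natr1 k3 !exprS.
  move: (r0 ^+ k) => s; rewrite /h /r0; field.
  by apply/and4P; split; rewrite gt_eqF //; nra.
have -> : M * (b * (1 - g) * ((1 + g ^+ 2 + 2 * d%:R * g) / (4 * (d%:R ^+ 2 - 1)))
    * ((1 - g) / (1 + g)) ^+ d) = (1 - g) * E by rewrite /E; ring.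
rewrite ler_wpM2r // /r0 ler_pdivrMr; nra.
Qed.

(** * The spectral theorem for real symmetric matrices *)

(** The complexified matrix is Hermitian, so its eigenvalues are real, and a real
    root of the characteristic polynomial is an eigenvalue over R as well. *)
Lemma symmetric_eigenvalue (R : realType) (n : nat) (A : 'M[R]_n.+1) :
  A^T = A -> exists l : R, eigenvalue A l.
Proof.
move=> Asym.
pose B := map_mx (real_complex R) A.
have Bherm : B \is hermsymmx.
  apply: realsym_hermsym.
    by apply/is_hermitianmxP; rewrite expr0 scale1r map_mx_id // /B map_trmx Asym.
  apply/mxOverP => i j; rewrite mxE; apply/complex_realP.
  by exists (A i j).
have /mxOverP/(_ 0 0)/complex_realP[l lE] := hermitian_spectral_diag_real Bherm.
have /orthomx_spectralP BE := hermitian_normalmx Bherm.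
exists l; rewrite eigenvalue_root_char -(fmorph_root (real_complex R)).
rewrite map_char_poly -eigenvalue_root_char.
have Punit := spectral_unit B.
apply/eigenvalueP; exists (row 0 (spectralmx B)).
  rewrite -/B {2}BE -row_mul !mulmxA mulmxV // mul1mx row_mul.
  by rewrite row_diag_mx -scalemxAl -rowE lE.
apply/eqP => r0; have /row_freeP[Q PQ] : row_free (spectralmx B).
  by rewrite row_free_unit.
move/matrixP/(_ 0 0): (congr1 (row 0) PQ).
by rewrite row_mul r0 mul0mx !mxE eqxx => /eqP; rewrite eq_sym oner_eq0.
Qed.

(** The reflection in the hyperplane orthogonal to v - e. *)
Lemma householder (R : realType) (n : nat) (v e : 'cV[R]_n) :
  v^T *m v = e^T *m e ->
  exists Q : 'M[R]_n, [/\ Q^T = Q, Q *m Q = 1%:M & Q *m v = e].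
Proof.
move=> nve; have [->|vNe] := eqVneq v e.
  by exists 1%:M; rewrite trmx1 !mul1mx.
pose w := v - e; pose s := (w^T *m w) 0 0.
have wwE : w^T *m w = s%:M by rewrite [LHS]mx11_scalar.
have s_neq0 : s != 0.
  apply: contraNneq vNe => /eqP; rewrite /s mxE psumr_eq0; last first.
    by move=> i _; rewrite mxE -expr2 sqr_ge0.
  move=> /allP w0; rewrite -subr_eq0; apply/eqP/colP => i.
  have /implyP/(_ isT) := w0 i (mem_index_enum _).
  by rewrite [w^T _ _]mxE mulf_eq0 orbb => /eqP; rewrite !mxE.
have evE : v^T *m e = e^T *m v.
  rewrite [LHS]mx11_scalar [RHS]mx11_scalar -[e^T *m v]trmxK trmx_mul trmxK.
  by rewrite [(v^T *m e)^T 0 0]mxE.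
have wv : w^T *m v = (s / 2)%:M.
  have -> : s = 2 * (w^T *m v) 0 0.
    have : w^T *m w = 2 *: (w^T *m v).
      rewrite /w !raddfB /= !mulmxBl nve -evE scaler_nat mulr2n.
      by rewrite opprB addrA addrC.
    by move=> /matrixP/(_ 0 0); rewrite -/s [in RHS]mxE.
  by rewrite mulrC mulKf ?pnatr_eq0 // -mx11_scalar.
exists (1%:M - (2 / s) *: (w *m w^T)); split.
- by rewrite raddfB /= trmx1 linearZ /= trmx_mul trmxK.
- rewrite mulmxBl mul1mx mulmxBr mulmx1 -scalemxAl -scalemxAr.
  rewrite mulmxA -(mulmxA w) wwE mul_mx_scalar -scalemxAl !scalerA.
  have -> : 2 / s * (2 / s * s) = 2 / s + 2 / s by field.
  by rewrite scalerDl opprB addrK subrK.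
rewrite mulmxBl mul1mx -scalemxAl -mulmxA wv mul_mx_scalar scalerA.
have -> : 2 / s * (s / 2) = 1 by field.
by rewrite scale1r /w opprB addrCA subrr addr0.
Qed.

(** A reflection taking a unit eigenvector to the first basis vector makes the
    matrix block diagonal, which gives an induction on the size. *)
Lemma symmetric_spectral_decomp (R : realType) (n : nat) (A : 'M[R]_n) :
  A^T = A -> exists (U : 'M[R]_n) (lam : 'rV[R]_n),
    U^T *m U = 1%:M /\ A = U *m diag_mx lam *m U^T.
Proof.
elim: n A => [|n IH] A Asym.
  by exists 1%:M, 0; split; apply/matrixP => -[].
have [l /eigenvalueP[u uA u_neq0]] := symmetric_eigenvalue Asym.
pose s := (u *m u^T) 0 0.
have s_gt0 : 0 < s.
  have s_ge0 : 0 <= s.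
    by rewrite /s mxE sumr_ge0 // => i _; rewrite mxE -expr2 sqr_ge0.
  rewrite lt_neqAle s_ge0 andbT; apply: contraNneq u_neq0 => /esym/eqP.
  rewrite /s mxE psumr_eq0; last by move=> i _; rewrite mxE -expr2 sqr_ge0.
  move=> /allP u0; apply/eqP/rowP => i.
  have /implyP/(_ isT) := u0 i (mem_index_enum _).
  by rewrite [u^T _ _]mxE mulf_eq0 orbb => /eqP; rewrite !mxE.
pose v := (Num.sqrt s)^-1 *: u^T.
pose e : 'cV[R]_(1 + n) := delta_mx (lshift n 0) 0.
have nve : v^T *m v = e^T *m e.
  rewrite [LHS]mx11_scalar [RHS]mx11_scalar; congr (_ %:M).
  rewrite /v [_^T]linearZ /= -scalemxAl -scalemxAr trmxK 2!mxE -/s.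
  rewrite /e trmx_delta mul_delta_mx mxE eqxx mulrA -invfM -expr2 sqr_sqrtr ?ltW //.
  by rewrite mulVf ?gt_eqF.
have [Q [Qsym QQ Qv]] := householder nve.
have Av : A *m v = l *: v.
  rewrite /v -scalemxAr scalerA mulrC -scalerA; congr (_ *: _).
  by apply: trmx_inj; rewrite trmx_mul trmxK Asym uA linearZ /= trmxK.
pose B : 'M[R]_(1 + n) := Q *m A *m Q.
have Bsym : B^T = B by rewrite /B !trmx_mul Qsym Asym mulmxA.
have Be : B *m e = l *: e.
  by rewrite /B -Qv -!mulmxA (mulmxA Q Q) QQ mul1mx Av -scalemxAr.
have Bcol i : B i (lshift n 0) = l * (i == lshift n 0)%:R.
  move/colP/(_ i): Be; rewrite -colE !mxE => ->.
  by rewrite eqxx andbT.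
have Bul : ulsubmx B = l%:M.
  apply/matrixP => i j; rewrite !ord1 2![LHS]mxE Bcol eqxx.
  by rewrite mulr1 mxE eqxx mulr1n.
have Bdl : dlsubmx B = 0.
  by apply/matrixP => i j; rewrite ord1 2![LHS]mxE Bcol eq_sym eq_lrshift mulr0 mxE.
have Bur : ursubmx B = 0 by rewrite -[B]Bsym -trmx_dlsub Bdl trmx0.
have Bdr : (drsubmx B)^T = drsubmx B by rewrite trmx_drsub Bsym.
have [V [mu [VV BE]]] := IH _ Bdr.
pose W : 'M[R]_(1 + n) := block_mx 1%:M 0 0 V.
have WT : W^T = block_mx 1%:M 0 0 V^T by rewrite tr_block_mx !trmx0 trmx1.
have WW : W^T *m W = 1%:M.
  rewrite WT mulmx_block !mulmx0 !mul0mx mulmx1 VV !addr0 add0r.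
  by rewrite -scalar_mx_block.
have BW : B = W *m diag_mx (row_mx l%:M mu) *m W^T.
  rewrite -[LHS]submxK Bul Bdl Bur BE diag_mx_row WT !mulmx_block.
  rewrite !mulmx0 !mul0mx !mulmx1 !mul1mx !addr0 !add0r.
  rewrite mul0mx; congr (block_mx _ _ _ _).
  by apply/matrixP => i j; rewrite !ord1 !mxE.
exists (Q *m W), (row_mx l%:M mu); split.
  by rewrite trmx_mul Qsym -mulmxA (mulmxA Q) QQ mul1mx.
have -> : A = Q *m B *m Q.
  by rewrite /B !mulmxA QQ mul1mx -mulmxA QQ mulmx1.
by rewrite trmx_mul Qsym BW !mulmxA.
Qed.

(** * The probing error as a functional on the spectrum *)

(** Walks may be shorter than k because diagonal entries of A act as loops, which
    are not edges. *)
Lemma expmx_walk (R : realType) (n : nat) (A : 'M[R]_n) (k : nat) (i j : 'I_n) :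
  (A ^+ k) i j != 0 ->
  exists p, [/\ path (edge A) i p, last i p = j & (size p <= k)%N].
Proof.
elim: k i => [|k IH] i.
  have [-> _|ij] := eqVneq i j; first by exists [::].
  by rewrite expr0 mxE (negPf ij) eqxx.
rewrite exprS mxE => sum_neq0.
have /existsP[m /andP[Aim Akmj]] : [exists m, (A i m != 0) && ((A ^+ k) m j != 0)].
  apply: contraNT sum_neq0 => /existsPn none; rewrite big1 // => m _.
  have := none m; rewrite negb_and !negbK.
  by move=> /orP[/eqP->|/eqP->]; rewrite ?mul0r ?mulr0.
have [p [pw pl ps]] := IH _ Akmj.
have [im|im] := eqVneq i m; first by exists p; rewrite im; split=> //; exact: leqW.
by exists (m :: p); rewrite /= /edge Aim im.
Qed.

Lemma probing_traceE (R : realType) (n : nat) (P : {set {set 'I_n}})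
    (F : 'M[R]_n) :
  probing_trace P F = \sum_(V in P) \sum_(i in V) \sum_(j in V) F i j.
Proof.
apply: eq_bigr => V _; rewrite /probing_vector [X in X *m _ *m _]linear_sum /=.
rewrite 2!mulmx_suml summxE.
apply: eq_bigr => i _; rewrite mulmx_sumr summxE; apply: eq_bigr => j _.
by rewrite trmx_delta -rowE -colE !mxE.
Qed.

(** Distinct nodes of one colour are at distance more than d >= k, so the
    corresponding entries of A ^+ k vanish and only the diagonal remains. *)
Lemma probing_trace_expmx (R : realType) (n : nat) (A : 'M[R]_n) (d k : nat)
    (P : {set {set 'I_n}}) :
  distance_coloring A d P -> (k <= d)%N ->
  probing_trace P (A ^+ k) = \tr (A ^+ k).
Proof.
move=> [Ppart Pcol] kd; have /and3P[/eqP Pcover Ptriv _] := Ppart.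
rewrite probing_traceE /mxtrace.
have -> : \sum_i (A ^+ k) i i = \sum_(V in P) \sum_(i in V) (A ^+ k) i i.
  rewrite -finset.big_trivIset //= Pcover.
  by apply: eq_bigl => i; rewrite finset.in_setT.
apply: eq_bigr => V VP; apply: eq_bigr => i iV.
rewrite (bigD1 i) //= big1 ?addr0 // => j /andP[jV ji].
apply: contraTeq isT => Aij; have [p [pw pl ps]] := expmx_walk Aij.
have ij : i != j by rewrite eq_sym.
suff /(Pcol _ _ ij) : (geodesic A i j <= d%:R%:E)%E.
  by rewrite (finset.def_pblock Ptriv VP iV) (finset.def_pblock Ptriv VP jV) eqxx.
apply: (@le_trans _ _ ((size p)%:R%:E)); last first.
  by rewrite lee_fin ler_nat (leq_trans ps).
by apply: ereal_inf_lbound; exists p.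
Qed.

Lemma spectral_decomp_expmx (R : realType) (n : nat) (A U : 'M[R]_n) (lam : 'rV[R]_n)
    (k : nat) :
  U^T *m U = 1%:M -> A = U *m diag_mx lam *m U^T ->
  A ^+ k = U *m diag_mx (map_mx (fun x => x ^+ k) lam) *m U^T.
Proof.
move=> UU AE; elim: k => [|k IH].
  have -> : diag_mx (map_mx (fun x => x ^+ 0) lam) = 1%:M.
    by apply/matrixP => i j; rewrite !mxE expr0.
  by rewrite mulmx1 (mulmx1C UU).
rewrite exprS IH {1}AE -[LHS]/(U *m diag_mx lam *m U^T
  *m (U *m diag_mx (map_mx (fun x => x ^+ k) lam) *m U^T)).
rewrite !mulmxA -(mulmxA _ U^T U) UU mulmx1 -(mulmxA U) mulmx_diag.
by congr (_ *m diag_mx _ *m _); apply/rowP => j; rewrite !mxE exprS.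
Qed.

Definition probing_weight (R : realType) (n : nat) (P : {set {set 'I_n}})
    (U : 'M[R]_n) (k : 'I_n) : R :=
  1 - \sum_(V in P) ((probing_vector R V)^T *m U) 0 k ^+ 2.

(** Both terms are linear in mu: the trace is the sum of mu, and each probing
    vector contributes its squared coordinates in the eigenbasis. *)
Lemma probing_error_spectral (R : realType) (n : nat) (P : {set {set 'I_n}})
    (U : 'M[R]_n) (mu : 'rV[R]_n) : U^T *m U = 1%:M ->
  \tr (U *m diag_mx mu *m U^T) - probing_trace P (U *m diag_mx mu *m U^T)
  = \sum_k probing_weight P U k * mu 0 k.
Proof.
move=> UU; rewrite mxtrace_mulC mulmxA UU mul1mx mxtrace_diag.
have -> : probing_trace P (U *m diag_mx mu *m U^T)
    = \sum_k \sum_(V in P) ((probing_vector R V)^T *m U) 0 k ^+ 2 * mu 0 k.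
  rewrite exchange_big /=; apply: eq_bigr => V _.
  set v := probing_vector R V.
  have -> : v^T *m (U *m diag_mx mu *m U^T) *m v
      = (v^T *m U) *m diag_mx mu *m (v^T *m U)^T.
    by rewrite trmx_mul trmxK !mulmxA.
  rewrite mxE; apply: eq_bigr => k _.
  by rewrite mul_mx_diag [X in X * _]mxE [X in _ * X]mxE; ring.
rewrite -sumrB; apply: eq_bigr => k _.
by rewrite -mulr_suml /probing_weight mulrBl mul1r.
Qed.

(** The total mass 2n comes from |w_k| <= 1 + (1 - w_k) = 2 - w_k together with
    sum_k w_k = 0, the case of the constant polynomial 1. *)
Lemma probing_error_functional (R : realType) (n : nat) (A : 'M[R]_n) (d : nat)
    (P : {set {set 'I_n}}) : A^T = A -> distance_coloring A d P ->
  exists lam w : 'I_n -> R, [/\ forall k, eigenvalue A (lam k),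
    forall f, \tr (matfun f A) - probing_trace P (matfun f A)
              = \sum_k w k * f (lam k),
    \sum_k `|w k| <= 2 * n%:R &
    forall q : {poly R}, (size q <= d.+1)%N -> \sum_k w k * q.[lam k] = 0].
Proof.
move=> Asym Pcol; have [U [lam [UU AE]]] := symmetric_spectral_decomp Asym.
exists (lam 0), (probing_weight P U).
have w_pow m : (m <= d)%N -> \sum_k probing_weight P U k * lam 0 k ^+ m = 0.
  move=> md; have := probing_error_spectral P (map_mx (fun x => x ^+ m) lam) UU.
  rewrite -(spectral_decomp_expmx m UU AE) (probing_trace_expmx Pcol md) subrr => w_m.
  by rewrite [RHS]w_m; apply: eq_bigr => k _; rewrite mxE.
split.
- move=> k; apply/eigenvalueP; exists (row k U^T).
    rewrite {1}AE -row_mul !mulmxA UU mul1mx row_mul row_diag_mx -scalemxAl -rowE //.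
  apply/eqP => r0; move/matrixP/(_ k k): UU.
  rewrite mxE big1 ?mxE ?eqxx; first by move/eqP; rewrite eq_sym oner_eq0.
  by move=> j _; move/rowP/(_ j): r0; rewrite !mxE => ->; rewrite mul0r.
- move=> f; rewrite (matfunE f UU AE) probing_error_spectral //.
  by apply: eq_bigr => k _; rewrite mxE.
- apply: (@le_trans _ _ (\sum_k (2 - probing_weight P U k))).
    apply: ler_sum => k _; rewrite /probing_weight.
    set s := \sum_(_ in _) _.
    have s0 : 0 <= s by apply: sumr_ge0 => V _; exact: sqr_ge0.
    by rewrite (le_trans (ler_normB _ _)) // normr1 ger0_norm //; lra.
  rewrite sumrB sumr_const card_ord mulr_natr.
  have := w_pow 0%N (leq0n _); under eq_bigr do rewrite expr0 mulr1.
  by move=> ->; rewrite subr0.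
move=> q sq; under eq_bigr do rewrite horner_coef mulr_sumr.
rewrite exchange_big big1 //= => m _.
under eq_bigr do rewrite mulrCA.
by rewrite -mulr_sumr w_pow ?mulr0 // -ltnS (leq_trans (ltn_ord m)).
Qed.

Theorem corollary3p2 (R : realType) (n : nat) (A : 'M[R]_n) (a b : R)
    (Asym : A^T = A)
    (a_ge0 : 0 <= a) (a_lt_b : a < b)
    (Aspec : forall x : R, eigenvalue A x -> a <= x <= b)
    (P : nat -> {set {set 'I_n}})
    (Pcol : forall d : nat, (2 <= d)%N -> distance_coloring A d (P d)) :
  let gamma := a / b in
  (forall d : nat, (2 <= d)%N ->
     `| vn_entropy A - probing_trace (P d) (matfun (@negxlnx R) A) |
     <= n%:R * b * (1 - Num.sqrt gamma)
        * ((1 + gamma + 2 * d%:R * Num.sqrt gamma) / (2 * (d%:R ^+ 2 - 1)))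
        * ((1 - Num.sqrt gamma) / (1 + Num.sqrt gamma)) ^+ d)
  /\
  (a = 0 -> forall d : nat, (2 <= d)%N ->
     `| vn_entropy A - probing_trace (P d) (matfun (@negxlnx R) A) |
     <= n%:R * b / (2 * (d%:R ^+ 2 - 1))).
Proof.
move=> gamma; pose g := Num.sqrt gamma.
have b_gt0 : 0 < b by exact: le_lt_trans a_lt_b.
have gamma_ge0 : 0 <= gamma by rewrite divr_ge0 // ltW.
have g2E : g ^+ 2 = gamma by exact: sqr_sqrtr.
have aE : b * g ^+ 2 = a by rewrite g2E /gamma mulrC divfK ?gt_eqF.
have gI : 0 <= g < 1.
  by rewrite sqrtr_ge0 -sqrtr1 ltr_sqrt // ltr_pdivrMr // mul1r.
have d_gt1 (d : nat) : (2 <= d)%N -> d%:R ^+ 2 - 1 != 0 :> R.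
  move=> d2; rewrite subr_eq0 -natrX pnatr_eq1.
  by apply: contraTneq d2; case: d => [|[|]].
have main (d : nat) : (2 <= d)%N ->
     `| vn_entropy A - probing_trace (P d) (matfun (@negxlnx R) A) |
     <= n%:R * b * (1 - g) * ((1 + gamma + 2 * d%:R * g) / (2 * (d%:R ^+ 2 - 1)))
        * ((1 - g) / (1 + g)) ^+ d.
  move=> d2; have [lam [w [lamA errE wM w0]]] :=
    probing_error_functional Asym (Pcol d d2).
  have lamI k : b * g ^+ 2 <= lam k <= b by rewrite aE; exact: Aspec.
  (* [negxlnx] is minus x ln x, so the norms agree; the mass is 2 n. *)
  have := entropy_functional_interval b_gt0 gI d2 lamI wM w0.
  rewrite /vn_entropy errE -normrN -sumrN /negxlnx.
  under eq_bigr do rewrite -mulrN.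
  move=> /le_trans; apply; rewrite le_eqVlt; apply/orP; left; apply/eqP.
  rewrite -g2E; move: (_ ^+ d) => s.
  field; exact: d_gt1.
split=> // a0 d d2.
have g0 : g = 0 by rewrite /g /gamma a0 mul0r sqrtr0.
have := main d d2; rewrite g0 /gamma a0.
by rewrite !(mul0r, mulr0, subr0, addr0, invr1, mulr1, expr1n, mul1r).
Qed.
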